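(* Let $A$ be a unital Banach algebra and let $X$ be a left unital Banach $A$-module. Denote by $X_1$ the set $\bigcup\operatorname{Im}\psi$, where $\psi$ runs over all small morphisms of Banach $A$-modules with codomain $X$, and denote by $X_2$ the set $\bigcap\operatorname{Im}\gamma$, where $\gamma$ runs over all maximal contractive monomorphisms with codomain $X$. Then $X_1=X_2$, and this submodule of $X$ is closed.
   Context: Banach algebras are over $\mathbb{C}$ with $\|ab\|\le\|a\|\|b\|$. A left Banach $A$-module is a Banach space with a left $A$-module structure such that $\|a\cdot x\|\le\|a\|\|x\|$; it is unital if $1\cdot x=x$ for all $x$. A morphism is a bounded $A$-linear map; a monomorphism is an injective morphism; contractive means of norm at most $1$. A morphism $\psi\colon X_0\to X$ is small if for every morphism $\phi\colon Y\to X$ of Banach $A$-modules, $\operatorname{Im}\phi+\operatorname{Im}\psi=X$ implies $\operatorname{Im}\phi=X$. A contractive monomorphism $\alpha\colon Y\to X$ of left unital Banach $A$-modules is maximal if $\alpha$ is not surjective and, for every non-surjective contractive monomorphism $\beta$ with codomain $X$ and every contractive morphism $\kappa$, the equality $\alpha=\beta\kappa$ implies that $\kappa$ is an isometric isomorphism. The intersection over an empty family of submodules of $X$ is $X$. *)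

(* Defs.v *)
(* MathComp / MathComp-Analysis. *)
From HB Require Import structures.
From mathcomp Require Import all_boot all_order all_algebra.
From mathcomp Require Import all_classical all_reals all_analysis.
From mathcomp Require Export complex.
Set Implicit Arguments.
Unset Strict Implicit.
Unset Printing Implicit Defensive.
Import Order.TTheory GRing.Theory Num.Theory.
Import numFieldNormedType.Exports.
Local Open Scope classical_set_scope.
Local Open Scope ring_scope.

(* Everything is over an arbitrary numFieldType [K]; the complex case is
   [K := R[i]] with [R : realType].  The norm of a [normedModType K] takes its
   values in [K]. *)

(* Unital Banach algebras; nothing is assumed on [`|1|], and the zero algebra is
   allowed.  The product and the unit are separate operations [bmul] and [bone],
   because Hierarchy Builder rejects a common substructure of [GRing.PzRing] and
   [NormedModule] declared after [Num.NumDomain]. *)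
HB.mixin Record isBanachAlgebra (K : numFieldType) A
    of CompleteNormedModule K A := {
  bmul : A -> A -> A;
  bone : A;
  bmulA : associative bmul;
  bmul1l : left_id bone bmul;
  bmul1r : right_id bone bmul;
  bmulDl : left_distributive bmul +%R;
  bmulDr : right_distributive bmul +%R;
  bmulZl : forall (k : K) (a b : A), bmul (k *: a) b = k *: bmul a b;
  bmulZr : forall (k : K) (a b : A), bmul a (k *: b) = k *: bmul a b;
  bmul_norm : forall a b : A, `|bmul a b| <= `|a| * `|b|
}.

#[short(type="banachAlgType")]
HB.structure Definition BanachAlgebra (K : numFieldType) :=
  {A of CompleteNormedModule K A & isBanachAlgebra K A}.

(* The action of the algebra is [lact]; [*:] is the action of the scalars [K].
   Unitality is not part of the structure. *)
HB.mixin Record isBanachModule (K : numFieldType) (A : banachAlgType K) X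
    of CompleteNormedModule K X := {
  lact : A -> X -> X;
  lactDl : forall (a b : A) (x : X), lact (a + b) x = lact a x + lact b x;
  lactDr : forall (a : A) (x y : X), lact a (x + y) = lact a x + lact a y;
  lactZl : forall (k : K) (a : A) (x : X), lact (k *: a) x = k *: lact a x;
  lactZr : forall (k : K) (a : A) (x : X), lact a (k *: x) = k *: lact a x;
  lactA : forall (a b : A) (x : X), lact (bmul a b) x = lact a (lact b x);
  lact_norm : forall (a : A) (x : X), `|lact a x| <= `|a| * `|x|
}.

#[short(type="banachModType")]
HB.structure Definition BanachModule (K : numFieldType) (A : banachAlgType K) :=
  {X of CompleteNormedModule K X & isBanachModule K A X}.

Section Morphisms.
Context {K : numFieldType} {A : banachAlgType K}.

Definition unital_module (X : banachModType A) : Prop :=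
  forall x : X, lact (bone : A) x = x.

Record morphism (X Y : banachModType A) := Morphism {
  morphism_fun :> {linear X -> Y};
  morphism_lact : forall (a : A) (x : X),
    morphism_fun (lact a x) = lact a (morphism_fun x);
  morphism_bounded : exists M : K,
    forall x : X, `|morphism_fun x| <= M * `|x|
}.

Definition contractive (X Y : banachModType A) (f : morphism X Y) : Prop :=
  forall x : X, `|f x| <= `|x|.

Definition surjective (X Y : banachModType A) (f : morphism X Y) : Prop :=
  range f = setT.

Definition isometric_iso (X Y : banachModType A) (f : morphism X Y) : Prop :=
  bijective f /\ forall x : X, `|f x| = `|x|.

Definition small (X0 X : banachModType A) (psi : morphism X0 X) : Prop :=
  forall (Y : banachModType A) (phi : morphism Y X),
    [set x + y | x in range phi & y in range psi] = setT -> range phi = setT.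

(* In the quantification over [beta] the module [Z] is automatically unital
   when [X] is, because [beta] is injective. *)
Definition maximal_mono (Y X : banachModType A) (alpha : morphism Y X) : Prop :=
  [/\ unital_module Y /\ unital_module X,
      contractive alpha /\ injective alpha,
      ~ surjective alpha &
      forall (Z : banachModType A) (beta : morphism Z X) (kappa : morphism Y Z),
        contractive beta -> injective beta -> ~ surjective beta ->
        contractive kappa -> alpha = beta \o kappa :> (Y -> X) ->
        isometric_iso kappa].

Definition is_submodule (X : banachModType A) (S : set X) : Prop :=
  [/\ S 0,
      forall x y : X, S x -> S y -> S (x + y),
      forall (k : K) (x : X), S x -> S (k *: x) &
      forall (a : A) (x : X), S x -> S (lact a x)].

Definition small_union (X : banachModType A) : set X :=
  [set x | exists (X0 : banachModType A) (psi : morphism X0 X),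
     small psi /\ range psi x].

Definition maximal_intersection (X : banachModType A) : set X :=
  [set x | forall (Y : banachModType A) (gamma : morphism Y X),
     maximal_mono gamma -> range gamma x].

End Morphisms.

Arguments small_union {K A} X.
Arguments maximal_intersection {K A} X.

(* Main.v *)
(** A maximal contractive monomorphism into [X] is onto a closed submodule [M]
    such that [X = M + A x] for every [x] outside [M]: otherwise the range of
    [M (+) A -> X], with its quotient norm, is a proper intermediate Banach
    module.  Such an [M] contains the image of every small morphism.
    Conversely, if [x] lies in every such [M], then [a |-> a x] is small: if
    [Im phi + A x = X] and [Im phi <> X], Zorn's lemma gives a submodule [M]
    containing [Im phi] and maximal among those not containing [x], so the
    inclusion of [M] would be a maximal contractive monomorphism as soon as
    [M] is closed.  In both directions closedness comes from the open mapping
    theorem combined with the Neumann series: for [s] in [M] close to [x] one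
    can write [x - s = phi y + a x] with [a] small, so [(1 - a) x] is in [M],
    and then so is [x] itself. *)
Require Import Defs.
From HB Require Import structures.
From mathcomp Require Import all_boot all_order all_algebra.
From mathcomp Require Import all_classical all_reals all_analysis.
From mathcomp Require Import ring lra.
Set Implicit Arguments.
Unset Strict Implicit.
Unset Printing Implicit Defensive.
Import Order.TTheory GRing.Theory Num.Theory.
Import numFieldNormedType.Exports.
Local Open Scope classical_set_scope.
Local Open Scope ring_scope.
Local Open Scope complex_scope.

(** * Norms of complex normed modules as real numbers *)

Section RealNorm.
Context {R : realType}.

(** Norms take values in [R[i]], which is only partially ordered. By [rnormE] the real part retains
    the whole norm, and in [R] infima and linear arithmetic are available. *)
Definition rnorm (V : normedModType R[i]) (x : V) : R := complex.Re `|x|.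

Section Theory.
Variable V : normedModType R[i].
Implicit Types x y : V.

Lemma rnormE x : `|x| = (rnorm x)%:C.
Proof. by rewrite /rnorm RRe_real// ger0_real. Qed.

Lemma rnorm_ge0 x : 0 <= rnorm x.
Proof. by rewrite -ler0c -rnormE. Qed.

Lemma rnorm0 : rnorm (0 : V) = 0.
Proof. by rewrite /rnorm normr0. Qed.

Lemma rnorm0_eq0 x : rnorm x = 0 -> x = 0.
Proof. by move=> x0; apply/eqP; rewrite -normr_eq0 rnormE x0. Qed.

Lemma rnormN x : rnorm (- x) = rnorm x.
Proof. by rewrite /rnorm normrN. Qed.

Lemma rnormBC x y : rnorm (x - y) = rnorm (y - x).
Proof. by rewrite -rnormN opprB. Qed.

Lemma rnormD x y : rnorm (x + y) <= rnorm x + rnorm y.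
Proof. by rewrite -lecR rmorphD/= -!rnormE ler_normD. Qed.

Lemma rnormB x y : rnorm (x - y) <= rnorm x + rnorm y.
Proof. by rewrite -(rnormN y) rnormD. Qed.

Lemma rnorm_triangle y x z : rnorm (x - z) <= rnorm (x - y) + rnorm (y - z).
Proof. by rewrite -[x - z](subrKA y) rnormD. Qed.

Lemma rnormZ (k : R[i]) x : rnorm (k *: x) = complex.Re `|k| * rnorm x.
Proof.
have := normrZ k x; rewrite !rnormE -(RRe_real (ger0_real (normr_ge0 k))).
by move=> /(congr1 (@complex.Re R)); rewrite /= mul0r subr0.
Qed.

Lemma rnormZr (k : R) x : 0 <= k -> rnorm (k%:C *: x) = k * rnorm x.
Proof. by move=> k0; rewrite rnormZ ger0_norm ?lecR. Qed.

Lemma ball_rnorm x (e : R) y : ball x e%:C y <-> rnorm (x - y) < e.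
Proof. by rewrite -ball_normE /ball_/= rnormE ltcR. Qed.

Lemma ball_rnormP (P : set V) x :
  nbhs x P <-> exists2 e : R, 0 < e & forall y, rnorm (x - y) < e -> P y.
Proof.
split.
  move=> /nbhs_ballP[e e0 eP]; have er : e = (complex.Re e)%:C.
    by rewrite RRe_real// gtr0_real.
  exists (complex.Re e); first by rewrite -ltcR -er.
  by move=> y xy; apply: eP; rewrite er; apply/ball_rnorm.
move=> [e e0 eP]; apply/nbhs_ballP; exists e%:C; first by rewrite /= ltcR.
by move=> y /ball_rnorm; exact: eP.
Qed.

Lemma closure_rnormP (S : set V) x :
  closure S x <-> forall e : R, 0 < e -> exists2 s, S s & rnorm (x - s) < e.
Proof.
split=> [Sx e e0|Sx B /ball_rnormP[e e0 eB]].
  have [|s [Ss xs]] := Sx [set y | rnorm (x - y) < e]; last by exists s.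
  by apply/ball_rnormP; exists e.
by have [s Ss xs] := Sx e e0; exists s; split=> //; exact: eB.
Qed.

End Theory.

Lemma rnorm_le (V W : normedModType R[i]) (x : V) (y : W) :
  (`|x| <= `|y|) = (rnorm x <= rnorm y).
Proof. by rewrite !rnormE lecR. Qed.

End RealNorm.

(** * Sequences whose steps at least halve *)

Section Halving.
Context {R : realType}.
Variable rho : nat -> R.
Hypotheses (rho_ge0 : forall n, 0 <= rho n)
  (rho_half : forall n, 2 * rho n.+1 <= rho n).

(** By induction [rho n * 2 ^ n <= rho 0], and [n < 2 ^ n]; the rest is the Archimedean property. *)
Lemma halving_lt (e : R) : 0 < e -> exists n, rho n < e.
Proof.
move=> e0.
have rho_le n : rho n * n.+1%:R <= rho 0%N.
  have : rho n * (2 ^ n)%:R <= rho 0%N.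
    elim: n => [|n]; first by rewrite expn0 mulr1.
    apply: le_trans; rewrite expnS natrM mulrA ler_wpM2r//.
    by rewrite mulrC.
  apply: le_trans; rewrite ler_wpM2l// ler_nat.
  exact: ltn_expl.
have [n ne] : exists n : nat, rho 0%N / e < n%:R.
  by exists (Num.truncn (rho 0%N / e)).+1; rewrite truncnS_gt.
exists n; rewrite ltNge; apply/negP => en.
have := rho_le n; apply/negP; rewrite -ltNge.
move: ne; rewrite ltr_pdivrMr// => /lt_le_trans; apply.
by rewrite mulrC ler_pM ?ler_nat ?(ltW e0).
Qed.

Lemma halving_eq0 (V : normedModType R[i]) (x : V) (C : R) :
  (forall n, rnorm x <= C * rho n) -> x = 0.
Proof.
move=> xC; apply: rnorm0_eq0; apply/eqP; rewrite eq_le rnorm_ge0 andbT.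
apply/ler_addgt0Pl => e e0; rewrite addr0.
have C1 : 0 < `|C| + 1 by rewrite ltr_wpDl.
have [n rn] := halving_lt (divr_gt0 e0 C1).
apply: le_trans (xC n) _; move: rn; rewrite ltr_pdivlMr// => /ltW.
apply: le_trans.
rewrite mulrC ler_wpM2l//.
by rewrite (le_trans (ler_norm _))// lerDl.
Qed.

Lemma halving_limit (E : completeNormedModType R[i]) (u : nat -> E) :
  (forall n, rnorm (u n.+1 - u n) <= rho n) ->
  exists l, forall n, rnorm (l - u n) <= 2 * rho n.
Proof.
move=> urho.
(* The halving hypothesis reads [rho m <= 2 * rho m - 2 * rho m.+1], so the bounds on the steps
   telescope. *)
have utail n k : rnorm (u (n + k)%N - u n) <= 2 * rho n - 2 * rho (n + k)%N.
  elim: k => [|k IH]; first by rewrite addn0 !subrr rnorm0.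
  rewrite addnS; apply: le_trans (rnorm_triangle (u (n + k)%N) _ _) _.
  have := urho (n + k)%N; have := rho_half (n + k)%N; lra.
have utail' n m : (n <= m)%N -> rnorm (u m - u n) <= 2 * rho n.
  move=> /subnKC <-; apply: le_trans (utail _ _) _.
  by rewrite gerBl mulr_ge0.
have : cvg (u @ \oo).
  apply: cauchy_cvg; apply: cauchy_exP => e e0.
  have er : e = (complex.Re e)%:C by rewrite RRe_real// gtr0_real.
  have [|n rn] := @halving_lt (complex.Re e / 2).
    by rewrite divr_gt0// -ltcR -er.
  exists (u n), n => // m /= nm; rewrite er; apply/ball_rnorm.
  by rewrite rnormBC; have := utail' n m nm; lra.
move=> /cvg_ex[l ul]; exists l => n; apply/ler_addgt0Pl => e e0.
have : nbhs l [set y | rnorm (l - y) < e] by apply/ball_rnormP; exists e.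
move=> /ul[N _ NP]; have /= lm := NP (maxn n N) (leq_maxr _ _).
apply: le_trans (rnorm_triangle (u (maxn n N)) _ _) _.
by rewrite lerD ?utail' ?leq_maxl// ltW.
Qed.

End Halving.

(** * Completeness tested on rapidly Cauchy sequences *)

Section PowersOfHalf.
Context {R : realType}.

Definition half_pow (n : nat) : R := 2^-1 ^+ n.

Lemma half_pow_gt0 n : 0 < half_pow n.
Proof. by rewrite exprn_gt0// invr_gt0. Qed.

Lemma half_powS n : half_pow n = 2 * half_pow n.+1.
Proof. by rewrite /half_pow exprS mulrA divff// mul1r. Qed.

Lemma half_pow_half n : 2 * half_pow n.+1 <= half_pow n.
Proof. by rewrite -half_powS. Qed.

(** A Cauchy filter contains balls of radius [half_pow n.+1]; consecutive ones meet, so their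
    centres form a rapidly Cauchy sequence, whose limit is the limit of the filter. The factor 4,
    instead of the 2 of [halving_limit], leaves room for quotient norms, where lifts are only nearly
    optimal. *)
Lemma cvg_of_halving_limit (E : normedModType R[i]) :
  (forall u : nat -> E, (forall n, rnorm (u n.+1 - u n) <= half_pow n) ->
    exists l, forall n, rnorm (l - u n) <= 4 * half_pow n) ->
  forall F : set_system E, ProperFilter F -> cauchy F -> cvg F.
Proof.
move=> Elim F FF /cauchyP Fc.
have /choice[u uF] n : exists x, F (ball x (half_pow n.+1)%:C).
  by apply: Fc; rewrite ltcR half_pow_gt0.
have [|l lu] := Elim u.
  move=> n; have [y [/ball_rnorm yn /ball_rnorm yn1]] :=
    filter_ex (filterI (uF n) (uF n.+1)).
  apply: le_trans (rnorm_triangle y _ _) _; rewrite [rnorm (y - _)]rnormBC.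
  have := half_powS n; have := half_powS n.+1; have := half_pow_gt0 n.+2.
  by move: yn yn1; lra.
apply/cvg_ex; exists l => B /ball_rnormP[e e0 eB].
(* The distance from [l] to a point of the n-th ball is below [4 * half_pow n + half_pow n.+1],
   hence below [5 * half_pow n]. *)
have e5 : 0 < e / 5 by rewrite divr_gt0.
have [n ne] := halving_lt (fun n => ltW (half_pow_gt0 n)) half_pow_half e5.
apply: filterS (uF n) => y /ball_rnorm ny; apply: eB.
apply: le_lt_trans (rnorm_triangle (u n) _ _) _.
have := lu n; have := half_powS n; have := half_pow_gt0 n; move: ny ne; lra.
Qed.

End PowersOfHalf.

(** * Neumann series in a Banach algebra *)

Section Neumann.
Context {R : realType} {A : banachAlgType R[i]}.
Implicit Types a b : A.

Lemma rnorm_bmul a b : rnorm (bmul a b) <= rnorm a * rnorm b.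
Proof.
have := bmul_norm a b; rewrite !rnormE.
by rewrite -[_%:C * _](rmorphM (real_complex R)) lecR.
Qed.

Lemma bmul0l b : bmul 0 b = 0.
Proof.
by have := bmulDl 0 0 b; rewrite addr0 => /eqP; rewrite -subr_eq subrr => /eqP.
Qed.

Lemma bmulBl a b c : bmul (a - b) c = bmul a c - bmul b c.
Proof. by apply/eqP; rewrite eq_sym subr_eq -bmulDl subrK. Qed.

Lemma bmulBr a b c : bmul a (b - c) = bmul a b - bmul a c.
Proof. by apply/eqP; rewrite eq_sym subr_eq -bmulDr subrK. Qed.

(* [v] is the Neumann series of [b]. *)
Lemma left_inverse_oneB b :
  rnorm b <= 2^-1 -> exists v, bmul v (bone - b) = bone.
Proof.
move=> b2; pose u n := iter n (fun v => bmul v b + bone) 0.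
pose rho n := rnorm (bone : A) * half_pow n.
have rho0 n : 0 <= rho n by rewrite mulr_ge0 ?rnorm_ge0 ?ltW ?half_pow_gt0.
have rhoS n : 2 * rho n.+1 <= rho n.
  by rewrite mulrCA ler_wpM2l ?rnorm_ge0 ?half_pow_half.
have urho n : rnorm (u n.+1 - u n) <= rho n.
  elim: n => [|n IH]; first by rewrite /rho/= bmul0l add0r subr0 mulr1.
  rewrite [u n.+2]/= [X in _ - X]/= opprD addrACA subrr addr0 -bmulBl.
  apply: le_trans (rnorm_bmul _ _) _; rewrite /rho /half_pow exprS mulrCA mulrC.
  by rewrite ler_pM ?rnorm_ge0.
have [l lu] := halving_limit rho0 rhoS urho.
exists l; rewrite bmulBr bmul1r; apply/eqP; rewrite -subr_eq0; apply/eqP.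
apply: (halving_eq0 rho0 rhoS (C := 2)) => n.
(* The recursion for [u n.+1] turns the defect of [l] into two approximation errors, each of norm at
   most [rho n]; this is where the constant 2 comes from. *)
have -> : l - bmul l b - bone = (l - u n.+1) + bmul (u n - l) b.
  by rewrite bmulBl /= [bmul (u n) b + bone]addrC opprD !addrA subrK addrAC.
apply: le_trans (rnormD _ _) _; have := rnorm_bmul (u n - l) b.
have := lu n; have := lu n.+1; have := rhoS n; rewrite rnormBC.
have : rnorm (u n - l) * rnorm b <= rnorm (u n - l) * 2^-1.
  by rewrite ler_wpM2l ?rnorm_ge0.
by rewrite [rnorm (l - u n)]rnormBC; lra.
Qed.

End Neumann.

(** * The open mapping theorem *)

Section OpenMapping.
Context {R : realType} (E F : completeNormedModType R[i]) (T : {linear E -> F}).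
Variables (M : R) (T_bounded : forall e, rnorm (T e) <= M * rnorm e).
Hypothesis T_surj : forall z, exists e, T e = z.

(* A Baire argument: otherwise, shrinking balls that avoid the images of larger
   and larger balls of [E] would converge to a point outside the range. *)
Lemma image_ball_dense_in_ball : exists (n : nat) (x : F) (r : R), 0 < r /\
  forall z, rnorm (z - x) < r -> forall eps : R, 0 < eps ->
    exists e, rnorm e <= n%:R /\ rnorm (T e - z) < eps.
Proof.
apply: contrapT => noball.
(* Here [s] is a radius in [E] together with the centre and radius of a ball in [F], and [t] is the
   next ball. Positivity of the radius stands after the existential so that [choice] yields a total
   function. *)
have avoid (s : nat * (F * R)) : exists t : F * R, 0 < s.2.2 ->
    [/\ rnorm (t.1 - s.2.1) < s.2.2, 0 < t.2, 2 * t.2 <= s.2.2 &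
      forall e, rnorm e <= s.1%:R -> 2 * t.2 < rnorm (T e - t.1)].
  case: s => n [x r] /=.
  have [r0|r0] := boolP (0 < r); last by exists (x, r).
  have : exists z (eps : R), [/\ rnorm (z - x) < r, 0 < eps &
      forall e, rnorm e <= n%:R -> eps <= rnorm (T e - z)].
    apply: contrapT => nz; apply: noball; exists n, x, r.
    split=> // z zx eps eps0.
    apply: contrapT => ne; apply: nz; exists z, eps; split=> // e en.
    by rewrite leNgt; apply/negP => lt; apply: ne; exists e.
  move=> [z [eps [zx eps0 zT]]]; exists (z, Num.min eps r / 4) => _ /=.
  have m0 : 0 < Num.min eps r by rewrite lt_min eps0 r0.
  have mr : Num.min eps r <= r by rewrite ge_min lexx orbT.
  have me : Num.min eps r <= eps by rewrite ge_min lexx.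
  split=> // [||e en]; [lra|lra|].
  by have := zT e en; lra.
have [f fP] := choice avoid.
pose fix s n := if n is m.+1 then f (m, s m) else (0 : F, 1 : R).
have s0 n : 0 < (s n).2.
  by elim: n => [|n IH]; rewrite ?ltr01//=; have [] := fP (n, s n) IH.
have sS n := fP (n, s n) (s0 n).
have s_ge0 n : 0 <= (s n).2 by exact: ltW.
have s_half n : 2 * (s n.+1).2 <= (s n).2 by have [] := sS n.
have s_step n : rnorm ((s n.+1).1 - (s n).1) <= (s n).2.
  by apply: ltW; have [] := sS n.
have [l ls] := halving_limit s_ge0 s_half s_step.
(* A preimage [e] of the limit has norm below some [n], so [T e = l] should be farther than twice
   the radius from the centre of ball [n.+1]; the limit estimate says the opposite. *)
have [e Te] := T_surj l.
pose n := (Num.truncn (rnorm e)).+1.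
have [_ _ _ /(_ e)] := sS n.
have en : rnorm e <= n%:R by rewrite ltW// truncnS_gt.
move=> /(_ en) /=; rewrite Te; apply/negP; rewrite -leNgt.
exact: (ls n.+1).
Qed.

(** Rescale [z] to norm [r / 2], lift both [x] and [x + k z] up to [r / 8], and subtract: the error
    [r / 4] is half of the rescaled norm. Writing [n.+1] in the constant keeps it positive when
    [n = 0]. *)
Lemma approximate_lifting : exists2 C : R, 0 < C &
  forall z, exists e, rnorm e <= C * rnorm z /\ 2 * rnorm (z - T e) <= rnorm z.
Proof.
have [n [x [r [r0 xr]]]] := image_ball_dense_in_ball.
exists (4 * n.+1%:R / r); first by rewrite divr_gt0 ?mulr_gt0.
move=> z; have [->|z0] := eqVneq z 0.
  by exists 0; rewrite linear0 subrr !rnorm0 !mulr0.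
have nz : 0 < rnorm z.
  rewrite lt_neqAle rnorm_ge0 eq_sym andbT.
  by apply: contra_neq z0 => /rnorm0_eq0.
pose k := r / (2 * rnorm z).
have k0 : 0 < k by rewrite divr_gt0 ?mulr_gt0.
have kz : k * rnorm z = r / 2 by rewrite /k; field; rewrite gt_eqF.
have r8 : 0 < r / 8 by rewrite divr_gt0.
have xkz : rnorm (x + k%:C *: z - x) < r.
  by rewrite addrAC subrr add0r rnormZr ?ltW// kz; lra.
have xx : rnorm (x - x) < r by rewrite subrr rnorm0.
have [e1 [e1n e1x]] := xr _ xkz _ r8.
have [e2 [e2n e2x]] := xr _ xx _ r8.
have ki0 : 0 <= k^-1 by rewrite invr_ge0 ltW.
have kK : k^-1%:C * k%:C = 1 :> R[i].
  by rewrite -(rmorphM (real_complex R)) mulVf ?gt_eqF.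
exists (k^-1%:C *: (e1 - e2)); split.
  rewrite rnormZr//; apply: (@le_trans _ _ (k^-1 * (2 * n.+1%:R))).
    rewrite ler_wpM2l//; apply: le_trans (rnormB _ _) _.
    by rewrite -natr1; lra.
  rewrite /k invf_div le_eqVlt; apply/orP; left; apply/eqP; field.
  by rewrite gt_eqF.
have -> : z - T (k^-1%:C *: (e1 - e2)) =
    k^-1%:C *: ((T e2 - x) - (T e1 - (x + k%:C *: z))).
  rewrite linearZ/= -{1}[z]scale1r -kK -scalerA -scalerBr; congr (_ *: _).
  by rewrite linearB !opprB -[x + _ - _]addrA subrKA addrCA.
rewrite rnormZr//; have := rnormB (T e2 - x) (T e1 - (x + k%:C *: z)).
move=> ?; rewrite mulrCA -ler_pdivlMl ?invr_gt0// invrK kz; lra.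
Qed.

(** Approximate lifting is iterated on the residual [res n]. Residuals halve, so the sum of the
    lifts converges, and summing the geometric bounds doubles the constant. *)
Theorem open_mapping : exists2 C : R, 0 < C &
  forall z, exists e, T e = z /\ rnorm e <= C * rnorm z.
Proof.
have [C C0 /choice[g gP]] := approximate_lifting.
exists (2 * C) => [|z]; first by rewrite mulr_gt0.
pose res n := iter n (fun w => w - T (g w)) z.
pose s n := \sum_(i < n) g (res i).
have res_ge0 n : 0 <= rnorm (res n) by exact: rnorm_ge0.
have res_half n : 2 * rnorm (res n.+1) <= rnorm (res n).
  by have [] := gP (res n).
have Cres_ge0 n : 0 <= C * rnorm (res n) by rewrite mulr_ge0// ltW.
have Cres_half n : 2 * (C * rnorm (res n.+1)) <= C * rnorm (res n).
  by rewrite mulrCA ler_pM2l.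
have s_step n : rnorm (s n.+1 - s n) <= C * rnorm (res n).
  by rewrite /s big_ord_recr/= addrAC subrr add0r; have [] := gP (res n).
have [e es] := halving_limit Cres_ge0 Cres_half s_step.
have Ts n : z - T (s n) = res n.
  elim: n => [|n IH]; first by rewrite /s big_ord0 linear0 subr0.
  by rewrite /s big_ord_recr/= linearD opprD addrA IH.
exists e; split; last by have := es 0%N; rewrite /s big_ord0 subr0 mulrA.
apply/eqP; rewrite -subr_eq0; apply/eqP.
apply: (halving_eq0 res_ge0 res_half (C := `|M| * (2 * C) + 1)) => n.
have -> : T e - z = T (e - s n) - res n by rewrite -Ts linearB opprB subrKA.
apply: le_trans (rnormB _ _) _; rewrite mulrDl mul1r lerD2r.
apply: le_trans (T_bounded _) _.
apply: (@le_trans _ _ (`|M| * rnorm (e - s n))).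
  by rewrite ler_wpM2r ?rnorm_ge0 ?ler_norm.
by rewrite -!mulrA ler_wpM2l// es.
Qed.

End OpenMapping.

(** * The algebra as a left module over itself *)

Section RegularModule.
Context {R : realType} (A : banachAlgType R[i]).

Definition regular_module : Type := A.

HB.instance Definition _ := CompleteNormedModule.copy regular_module A.

HB.instance Definition _ := isBanachModule.Build R[i] A regular_module
  (@bmulDl _ A) (@bmulDr _ A) (@bmulZl _ A)
  (fun k a => @bmulZr _ A k a) (fun a b c => esym (@bmulA _ A a b c))
  (@bmul_norm _ A).

End RegularModule.

(** * Direct sums of Banach modules *)

Section DirectSum.
Context {R : realType} {A : banachAlgType R[i]} (Y W : banachModType A).

(** A separate name for the product, whose usual norm is the maximum. With the sum norm,
    [(y, w) |-> f y + g w] is contractive as soon as [f] and [g] are. *)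
Definition direct_sum : Type := (Y * W)%type.

HB.instance Definition _ := GRing.Lmodule.copy direct_sum (Y * W)%type.

Implicit Types u v : direct_sum.

Definition sum_norm u : R[i] := `|u.1| + `|u.2|.

Lemma sum_normD u v : sum_norm (u + v) <= sum_norm u + sum_norm v.
Proof. by rewrite /sum_norm addrACA lerD ?ler_normD. Qed.

Lemma sum_normZ (k : R[i]) u : sum_norm (k *: u) = `|k| * sum_norm u.
Proof. by rewrite /sum_norm mulrDr !normrZ. Qed.

Lemma sum_norm0_eq0 u : sum_norm u = 0 -> u = 0.
Proof.
case: u => y w /eqP; rewrite paddr_eq0//= !normr_eq0.
by move=> /andP[/eqP-> /eqP->].
Qed.

HB.instance Definition _ :=
  Lmodule_isNormed.Build R[i] direct_sum sum_normD sum_normZ sum_norm0_eq0.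

Lemma rnorm_direct_sum u : rnorm u = rnorm u.1 + rnorm u.2.
Proof.
rewrite /rnorm [Num.norm u]/(sum_norm u) /sum_norm.
by case: `|u.1|; case: `|u.2|.
Qed.

Lemma direct_sum_complete (F : set_system direct_sum) :
  ProperFilter F -> cauchy F -> cvg F.
Proof.
apply: cvg_of_halving_limit => u us.
have p0 n := ltW (@half_pow_gt0 R n).
have [n|y yu] := halving_limit (u := fun n => (u n).1) p0 half_pow_half.
  apply: le_trans (us n); rewrite rnorm_direct_sum.
  by rewrite lerDl rnorm_ge0.
have [n|w wu] := halving_limit (u := fun n => (u n).2) p0 half_pow_half.
  apply: le_trans (us n); rewrite rnorm_direct_sum.
  by rewrite lerDr rnorm_ge0.
exists (y, w) => n; rewrite rnorm_direct_sum/=.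
by have := yu n; have := wu n; lra.
Qed.

HB.instance Definition _ :=
  Uniform_isComplete.Build direct_sum direct_sum_complete.

Definition sum_lact (a : A) u : direct_sum := (lact a u.1, lact a u.2).

Lemma sum_lactDl a b u : sum_lact (a + b) u = sum_lact a u + sum_lact b u.
Proof. by rewrite /sum_lact !lactDl. Qed.

Lemma sum_lactDr a u v : sum_lact a (u + v) = sum_lact a u + sum_lact a v.
Proof. by rewrite /sum_lact !lactDr. Qed.

Lemma sum_lactZl k a u : sum_lact (k *: a) u = k *: sum_lact a u.
Proof. by rewrite /sum_lact !lactZl. Qed.

Lemma sum_lactZr k a u : sum_lact a (k *: u) = k *: sum_lact a u.
Proof. by rewrite /sum_lact !lactZr. Qed.

Lemma sum_lactA a b u : sum_lact (bmul a b) u = sum_lact a (sum_lact b u).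
Proof. by rewrite /sum_lact !lactA. Qed.

Lemma sum_lact_norm (a : A) u : `|sum_lact a u| <= `|a| * `|u|.
Proof. by rewrite mulrDr lerD ?lact_norm. Qed.

HB.instance Definition _ := isBanachModule.Build R[i] A direct_sum
  sum_lactDl sum_lactDr sum_lactZl sum_lactZr sum_lactA sum_lact_norm.

End DirectSum.

(** * Banach modules from submodules with a complete norm *)

Section NormedSubmodule.
Context {R : realType} {A : banachAlgType R[i]}.

(* A submodule [nsub_set] with a complete norm [nsub_norm] of its own, possibly
   finer than the norm of [X]; the values of [nsub_norm] off [nsub_set] are
   irrelevant. *)
Record normed_submodule (X : banachModType A) := NormedSubmodule {
  nsub_set : set X;
  nsub_norm : X -> R;
  nsub_submodule : is_submodule nsub_set;
  nsub_norm_ge : forall x, nsub_set x -> rnorm x <= nsub_norm x;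
  nsub_normD : forall x y, nsub_set x -> nsub_set y ->
    nsub_norm (x + y) <= nsub_norm x + nsub_norm y;
  nsub_normZ : forall (k : R[i]) x, nsub_set x ->
    nsub_norm (k *: x) = complex.Re `|k| * nsub_norm x;
  nsub_norm_lact : forall (a : A) x, nsub_set x ->
    nsub_norm (lact a x) <= rnorm a * nsub_norm x;
  nsub_complete : forall u : nat -> X, (forall n, nsub_set (u n)) ->
    (forall n, nsub_norm (u n.+1 - u n) <= half_pow n) ->
    exists2 l, nsub_set l & forall n, nsub_norm (l - u n) <= 4 * half_pow n
}.

Variables (X : banachModType A) (S : normed_submodule X).

Definition nsub_pred : {pred X} := fun x => `[< nsub_set S x >].

Lemma nsub_predP x : reflect (nsub_set S x) (x \in nsub_pred).
Proof. exact: asboolP. Qed.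

Lemma nsub_pred_closed : submod_closed nsub_pred.
Proof.
have [S0 SD SZ _] := nsub_submodule S; split; first exact/nsub_predP.
move=> k x y /nsub_predP Sx /nsub_predP Sy.
by apply/nsub_predP/SD => //; exact: SZ.
Qed.

HB.instance Definition _ :=
  GRing.isSubmodClosed.Build R[i] X nsub_pred nsub_pred_closed.

Record nsub_type := NSub { nsub_val : X; _ : nsub_val \in nsub_pred }.

HB.instance Definition _ := [isSub for nsub_val].
HB.instance Definition _ := [Choice of nsub_type by <:].
HB.instance Definition _ := [SubChoice_isSubLmodule of nsub_type by <:].

Implicit Types z : nsub_type.

Lemma nsub_valP z : nsub_set S (\val z).
Proof. exact/nsub_predP/valP. Qed.

Definition nsub_cnorm z : R[i] := (nsub_norm S (\val z))%:C.

Lemma nsub_cnormD z1 z2 : nsub_cnorm (z1 + z2) <= nsub_cnorm z1 + nsub_cnorm z2.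
Proof.
rewrite -[X in _ <= X](rmorphD (real_complex R)) lecR.
by rewrite raddfD nsub_normD//; exact: nsub_valP.
Qed.

Lemma nsub_cnormZ (k : R[i]) z : nsub_cnorm (k *: z) = `|k| * nsub_cnorm z.
Proof.
rewrite /nsub_cnorm linearZ/= nsub_normZ; last exact: nsub_valP.
exact: (rmorphM (real_complex R)).
Qed.

Lemma nsub_cnorm0_eq0 z : nsub_cnorm z = 0 -> z = 0.
Proof.
move=> /complexI z0; apply/val_inj; rewrite raddf0; apply/rnorm0_eq0/eqP.
by rewrite eq_le rnorm_ge0 andbT -z0 nsub_norm_ge//; exact: nsub_valP.
Qed.

HB.instance Definition _ :=
  Lmodule_isNormed.Build R[i] nsub_type nsub_cnormD nsub_cnormZ nsub_cnorm0_eq0.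

Lemma rnorm_nsub z : rnorm z = nsub_norm S (\val z).
Proof. by []. Qed.

Lemma nsub_type_complete (F : set_system nsub_type) :
  ProperFilter F -> cauchy F -> cvg F.
Proof.
apply: cvg_of_halving_limit => u us.
have uS n : nsub_set S (\val (u n)) by exact: nsub_valP.
have [n|l Sl lu] := nsub_complete uS; first by rewrite -raddfB; exact: us.
exists (NSub (introT (nsub_predP l) Sl)) => n.
by rewrite rnorm_nsub raddfB; exact: lu.
Qed.

HB.instance Definition _ :=
  Uniform_isComplete.Build nsub_type nsub_type_complete.

Lemma nsub_lact_subproof (a : A) z : lact a (\val z) \in nsub_pred.
Proof.
by have [_ _ _ Sa] := nsub_submodule S; apply/nsub_predP/Sa/nsub_valP.
Qed.

Definition nsub_lact a z : nsub_type := NSub (nsub_lact_subproof a z).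

Lemma nsub_lactDl a b z : nsub_lact (a + b) z = nsub_lact a z + nsub_lact b z.
Proof. by apply: val_inj; rewrite raddfD; exact: lactDl. Qed.

Lemma nsub_lactDr a z1 z2 :
  nsub_lact a (z1 + z2) = nsub_lact a z1 + nsub_lact a z2.
Proof.
apply: val_inj; rewrite raddfD; apply: etrans (lactDr _ _ _).
by congr lact; exact: raddfD.
Qed.

Lemma nsub_lactZl k a z : nsub_lact (k *: a) z = k *: nsub_lact a z.
Proof. by apply: val_inj; rewrite linearZ; exact: lactZl. Qed.

Lemma nsub_lactZr k a z : nsub_lact a (k *: z) = k *: nsub_lact a z.
Proof.
apply: val_inj; rewrite linearZ; apply: etrans (lactZr _ _ _).
by congr lact; exact: linearZ.
Qed.

Lemma nsub_lactA a b z : nsub_lact (bmul a b) z = nsub_lact a (nsub_lact b z).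
Proof. by apply: val_inj; exact: lactA. Qed.

Lemma nsub_lact_norm (a : A) z : `|nsub_lact a z| <= `|a| * `|z|.
Proof.
rewrite !rnormE -[X in _ <= X](rmorphM (real_complex R)) lecR.
by rewrite !rnorm_nsub nsub_norm_lact//; exact: nsub_valP.
Qed.

HB.instance Definition _ := isBanachModule.Build R[i] A nsub_type
  nsub_lactDl nsub_lactDr nsub_lactZl nsub_lactZr nsub_lactA nsub_lact_norm.

End NormedSubmodule.

(** * Morphisms, submodules and closures *)

Section Morphisms.
Context {R : realType} {A : banachAlgType R[i]}.
Implicit Types X Y : banachModType A.

Lemma rnorm_lact X (a : A) (x : X) : rnorm (lact a x) <= rnorm a * rnorm x.
Proof.
have := lact_norm a x; rewrite !rnormE.
by rewrite -[_%:C * _](rmorphM (real_complex R)) lecR.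
Qed.

Lemma lactBr X (a : A) (x y : X) : lact a (x - y) = lact a x - lact a y.
Proof. by apply/eqP; rewrite eq_sym subr_eq -lactDr subrK. Qed.

Lemma morphism_rnorm_le X Y (f : morphism X Y) :
  exists M : R, forall x, rnorm (f x) <= M * rnorm x.
Proof.
have [M fM] := morphism_bounded f; exists (complex.Re M) => x.
have := fM x; rewrite !rnormE lecE => /andP[_].
by case: M {fM} => m m' /=; rewrite mulr0 subr0.
Qed.

Definition build_morphism X Y (f : X -> Y) (f_linear : linear f)
    (f_lact : forall (a : A) x, f (lact a x) = lact a (f x))
    (f_bounded : exists M : R, forall x, rnorm (f x) <= M * rnorm x) :
  morphism X Y.
Proof.
pose g : {linear X -> Y} := HB.pack f (GRing.isLinear.Build _ _ _ _ f f_linear).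
apply: (@Morphism R[i] A X Y g f_lact).
have [M fM] := f_bounded; exists M%:C => x.
by rewrite !rnormE -[_ * _](rmorphM (real_complex R)) lecR.
Defined.

Lemma range_submodule X Y (f : morphism Y X) : is_submodule (range f).
Proof.
split; first by exists 0; rewrite // linear0.
- by move=> _ _ [y _ <-] [z _ <-]; exists (y + z); rewrite // linearD.
- by move=> k _ [y _ <-]; exists (k *: y); rewrite // linearZ.
- by move=> a _ [y _ <-]; exists (lact a y); rewrite // morphism_lact.
Qed.

Lemma submoduleB X (S : set X) x y : is_submodule S -> S x -> S y -> S (x - y).
Proof.
by move=> [_ SD SZ _] Sx Sy; apply: SD => //; rewrite -scaleN1r; exact: SZ.
Qed.

Lemma closure_submodule X (S : set X) :
  is_submodule S -> is_submodule (closure S).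
Proof.
move=> [S0 SD SZ Sa]; split; first exact: subset_closure.
- move=> x y /closure_rnormP Sx /closure_rnormP Sy.
  apply/closure_rnormP => e e0.
  have e2 : 0 < e / 2 by rewrite divr_gt0.
  have [s Ss xs] := Sx _ e2; have [t St yt] := Sy _ e2.
  exists (s + t); first exact: SD.
  rewrite opprD addrACA; apply: le_lt_trans (rnormD _ _) _; lra.
- move=> k x /closure_rnormP Sx; apply/closure_rnormP => e e0.
  (* Adding 1 keeps the divisor positive when [k = 0]; the same device serves for the action of [a]
     below. *)
  have k1 : 0 < complex.Re `|k| + 1.
    by rewrite ltr_wpDl// -ler0c RRe_real// ger0_real.
  have [s Ss xs] := Sx _ (divr_gt0 e0 k1).
  exists (k *: s); first exact: SZ.
  rewrite -scalerBr rnormZ; move: xs; rewrite ltr_pdivlMr// mulrDr mulr1.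
  by rewrite mulrC; have := rnorm_ge0 (x - s); lra.
- move=> a x /closure_rnormP Sx; apply/closure_rnormP => e e0.
  have a1 : 0 < rnorm a + 1 by rewrite ltr_wpDl// rnorm_ge0.
  have [s Ss xs] := Sx _ (divr_gt0 e0 a1).
  exists (lact a s); first exact: Sa.
  rewrite -lactBr; apply: le_lt_trans (rnorm_lact _ _) _.
  move: xs; rewrite ltr_pdivlMr// mulrDr mulr1.
  by rewrite mulrC; have := rnorm_ge0 (x - s); lra.
Qed.

Definition nsub_incl X (S : normed_submodule X) : morphism (nsub_type S) X.
Proof.
apply: (@build_morphism _ _ (fun z : nsub_type S => nsub_val z)).
- exact: (linearP \val).
- by [].
- exists 1 => z; rewrite mul1r rnorm_nsub nsub_norm_ge//; exact: nsub_valP.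
Defined.

Lemma nsub_incl_contractive X (S : normed_submodule X) :
  contractive (nsub_incl S).
Proof. by move=> z; rewrite rnorm_le nsub_norm_ge//; exact: nsub_valP. Qed.

Lemma nsub_incl_inj X (S : normed_submodule X) : injective (nsub_incl S).
Proof. by move=> z w; exact: val_inj. Qed.

Lemma range_nsub_incl X (S : normed_submodule X) :
  range (nsub_incl S) = nsub_set S.
Proof.
apply/seteqP; split=> [_ [z _ <-]|x Sx]; first exact: nsub_valP.
by exists (NSub (introT (nsub_predP S x) Sx)).
Qed.

Definition corestriction X Y (S : normed_submodule X) (f : morphism Y X)
    (fS : forall y, nsub_set S (f y))
    (fN : forall y, nsub_norm S (f y) <= rnorm y) : morphism Y (nsub_type S).
Proof.
apply: (@build_morphism _ _
  (fun y => NSub (introT (nsub_predP S (f y)) (fS y)))).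
- by move=> k y z; apply: val_inj; rewrite [RHS](linearP \val); exact: linearP.
- by move=> a y; apply: val_inj; exact: morphism_lact.
- by exists 1 => y; rewrite mul1r; exact: fN.
Defined.

Lemma closed_submodule_complete X (S : set X) : closed S ->
  forall u : nat -> X, (forall n, S (u n)) ->
    (forall n, rnorm (u n.+1 - u n) <= half_pow n) ->
  exists2 l, S l & forall n, rnorm (l - u n) <= 4 * half_pow n.
Proof.
move=> S_closed u Su us.
have [l lu] := halving_limit (fun n => ltW (half_pow_gt0 n)) half_pow_half us.
exists l; last first.
  by move=> n; apply: le_trans (lu n) _; have := @half_pow_gt0 R n; lra.
apply/S_closed/closure_rnormP => e e0.
have e2 : 0 < e / 2 by rewrite divr_gt0.
have [n ne] := halving_lt (fun n => ltW (half_pow_gt0 n)) half_pow_half e2.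
by exists (u n) => //; apply: le_lt_trans (lu n) _; lra.
Qed.

Definition closed_normed_submodule X (S : set X) (S_sub : is_submodule S)
    (S_closed : closed S) : normed_submodule X :=
  @NormedSubmodule R A X S (@rnorm R X) S_sub (fun x _ => lexx (rnorm x))
    (fun x y _ _ => rnormD x y) (fun k x _ => rnormZ k x)
    (fun a x _ => rnorm_lact a x) (closed_submodule_complete S_closed).

Lemma sum_morphism_bounded X Y W (f : morphism Y X) (g : morphism W X) :
  exists M : R, forall u : direct_sum Y W, rnorm (f u.1 + g u.2) <= M * rnorm u.
Proof.
have [M fM] := morphism_rnorm_le f; have [N gN] := morphism_rnorm_le g.
exists (`|M| + `|N|) => u; rewrite rnorm_direct_sum.
apply: le_trans (rnormD _ _) _; rewrite mulrDl !mulrDr.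
have fM' : rnorm (f u.1) <= `|M| * rnorm u.1.
  by rewrite (le_trans (fM _))// ler_wpM2r ?rnorm_ge0 ?ler_norm.
have gN' : rnorm (g u.2) <= `|N| * rnorm u.2.
  by rewrite (le_trans (gN _))// ler_wpM2r ?rnorm_ge0 ?ler_norm.
have : 0 <= `|M| * rnorm u.2 by rewrite mulr_ge0 ?rnorm_ge0.
have : 0 <= `|N| * rnorm u.1 by rewrite mulr_ge0 ?rnorm_ge0.
lra.
Qed.

Definition sum_morphism X Y W (f : morphism Y X) (g : morphism W X) :
  morphism (direct_sum Y W) X.
Proof.
apply: (build_morphism _ _ (sum_morphism_bounded f g)).
- by move=> k u v; rewrite /= !linearP scalerDr addrACA.
- by move=> a u; rewrite !morphism_lact lactDr.
Defined.

Definition orbit_morphism X (x : X) : morphism (regular_module A) X.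
Proof.
apply: (@build_morphism _ _ (fun a : regular_module A => lact (a : A) x)).
- by move=> k a b; rewrite lactDl lactZl.
- by move=> a b; rewrite -lactA.
- by exists (rnorm x) => a; rewrite mulrC rnorm_lact.
Defined.

End Morphisms.

(** * The quotient norm on the range of a contractive morphism *)

Section QuotientNorm.
Context {R : realType} {A : banachAlgType R[i]} (E X : banachModType A).
Variable T : morphism E X.
Hypothesis T_contr : contractive T.

(** The norm of [E / ker T] transported to the range of [T]. Off the range it is the infimum of the
    empty set, a default value, hence the hypotheses [range T x] below. *)
Definition quotient_norm (x : X) : R :=
  inf [set rnorm e | e in T @^-1` [set x]].

Lemma quotient_norm_le e : quotient_norm (T e) <= rnorm e.
Proof.
by apply: ge_inf; [exists 0 => _ [? _ <-]; exact: rnorm_ge0|exists e].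
Qed.

Lemma quotient_norm_glb (k c : R) x : range T x -> 0 <= k ->
  (forall e, T e = x -> c <= k * rnorm e) -> c <= k * quotient_norm x.
Proof.
move=> [e0 _ e0x]; rewrite le_eqVlt => /orP[/eqP <- /(_ e0 e0x)|k0 ce].
  by rewrite !mul0r.
rewrite -ler_pdivrMl//; apply: lb_le_inf; first by exists (rnorm e0), e0.
by move=> _ [e ex <-]; rewrite ler_pdivrMl// ce.
Qed.

Lemma quotient_norm_lift x (eps : R) : range T x -> 0 < eps ->
  exists e, T e = x /\ rnorm e <= quotient_norm x + eps.
Proof.
move=> [e0 _ e0x] eps0.
have [|_ [e ex <-] lt] :=
  @inf_adherent _ [set rnorm e | e in T @^-1` [set x]] _ eps0.
  by split; [exists (rnorm e0), e0|exists 0 => _ [? _ <-]; exact: rnorm_ge0].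
by exists e; split; rewrite ?ltW.
Qed.

(** The differences are lifted to [E] and summed there, and the limit is mapped back. The infimum
    need not be attained, so the lifts [d n] only obey the bound [2 * half_pow n], and the limit
    estimate doubles it again. *)
Lemma quotient_norm_complete (u : nat -> X) : (forall n, range T (u n)) ->
  (forall n, quotient_norm (u n.+1 - u n) <= half_pow n) ->
  exists2 l, range T l & forall n, quotient_norm (l - u n) <= 4 * half_pow n.
Proof.
move=> Tu us.
have /choice[d dP] n :
    exists d, T d = u n.+1 - u n /\ rnorm d <= 2 * half_pow n.
  have p0 := @half_pow_gt0 R n.
  have Tud := submoduleB (range_submodule T) (Tu n.+1) (Tu n).
  have [d [Td dn]] := quotient_norm_lift Tud p0.
  by exists d; split=> //; have := us n; lra.
have [e0 _ Te0] := Tu 0%N.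
pose s n := e0 + \sum_(i < n) d i.
have Ts n : T (s n) = u n.
  elim: n => [|n IH]; first by rewrite /s big_ord0 addr0.
  by rewrite /s big_ord_recr/= addrA linearD IH (dP n).1 addrC subrK.
have p0 n : 0 <= 2 * half_pow n :> R by rewrite mulr_ge0// ltW// half_pow_gt0.
have pS n : 2 * (2 * half_pow n.+1) <= 2 * half_pow n :> R.
  by rewrite -half_powS.
have [n|l ls] := halving_limit (u := s) p0 pS.
  have -> : s n.+1 - s n = d n.
    by rewrite /s big_ord_recr/= addrA [X in X - _]addrC addrK.
  exact: (dP n).2.
exists (T l) => [|n]; first by exists l.
rewrite -Ts -linearB; apply: le_trans (quotient_norm_le _) _.
by apply: le_trans (ls n) _; lra.
Qed.

Lemma quotient_norm_ge x : range T x -> rnorm x <= quotient_norm x.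
Proof.
move=> Tx; rewrite -[quotient_norm x]mul1r.
by apply: quotient_norm_glb => // e <-; rewrite mul1r -rnorm_le.
Qed.

Lemma quotient_normD x y : range T x -> range T y ->
  quotient_norm (x + y) <= quotient_norm x + quotient_norm y.
Proof.
move=> Tx Ty; rewrite -lerBlDr -[quotient_norm x]mul1r.
apply: quotient_norm_glb => // e <-; rewrite mul1r lerBlDr -lerBlDl.
rewrite -[quotient_norm y]mul1r.
apply: quotient_norm_glb => // e' <-; rewrite mul1r lerBlDl -linearD.
by rewrite (le_trans (quotient_norm_le _))// rnormD.
Qed.

Lemma quotient_normZ (k : R[i]) x : range T x ->
  quotient_norm (k *: x) = complex.Re `|k| * quotient_norm x.
Proof.
move=> Tx; have [T0 _ TZ _] := range_submodule T.
have k_ge0 : 0 <= complex.Re `|k| by rewrite -ler0c RRe_real// ger0_real.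
apply/le_anti/andP; split.
  apply: quotient_norm_glb => // e <-.
  by rewrite -linearZ/= -rnormZ quotient_norm_le.
(* For the reverse inequality a lift of [k *: x] is divided by [k], so [k = 0] is treated apart. *)
have [->|k0] := eqVneq k 0.
  rewrite normr0 mul0r scale0r -[quotient_norm _]mul1r.
  by apply: quotient_norm_glb => // e _; rewrite mul1r rnorm_ge0.
rewrite -[quotient_norm (k *: x)]mul1r.
apply: quotient_norm_glb => // [|e ex]; first exact: TZ.
have <- : T (k^-1 *: e) = x by rewrite linearZ/= ex scalerA mulVf// scale1r.
rewrite mul1r -[rnorm e]mul1r.
apply: le_trans (ler_wpM2l k_ge0 (quotient_norm_le _)) _.
by rewrite -rnormZ scalerA divff// scale1r mul1r.
Qed.

Lemma quotient_norm_lact (a : A) x : range T x ->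
  quotient_norm (lact a x) <= rnorm a * quotient_norm x.
Proof.
move=> Tx; apply: quotient_norm_glb => // [|e <-]; first exact: rnorm_ge0.
by rewrite -morphism_lact (le_trans (quotient_norm_le _))//; exact: rnorm_lact.
Qed.

Definition range_normed_submodule : normed_submodule X :=
  NormedSubmodule (range_submodule T) quotient_norm_ge quotient_normD
    quotient_normZ quotient_norm_lact quotient_norm_complete.

End QuotientNorm.

(** * Modules generated by one element modulo a range; maximal submodules and smallness *)

Section CyclicModuloRange.
Context {R : realType} {A : banachAlgType R[i]} (X : banachModType A).
Hypothesis X_unital : unital_module X.

(** The common source of closedness: it is applied to the range of a maximal monomorphism and to the
    submodule supplied by Zorn's lemma. *)
Lemma closure_cyclic_generator (Y : banachModType A) (phi : morphism Y X)
    (x : X) (S : set X) :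
  (forall z, exists y (a : A), z = phi y + lact a x) ->
  is_submodule S -> range phi `<=` S -> closure S x -> S x.
Proof.
move=> gen S_sub phiS /closure_rnormP Sx.
pose T := sum_morphism phi (orbit_morphism x).
have [M TM] := morphism_rnorm_le T.
have [|C C0 TC] := @open_mapping _ _ _ T M TM.
  by move=> z; have [y [a ->]] := gen z; exists (y, a).
(* At this distance the lift [(y, a)] of [x - s] has norm below 1/2, so [1 - a] has a left
   inverse. *)
have C2 : 0 < 2^-1 / C by rewrite divr_gt0 ?invr_gt0.
have [s Ss xs] := Sx _ C2.
have [[y a] [Tya ya]] := TC (x - s).
have [v va] : exists v, bmul v (bone - (a : A)) = bone.
  apply: left_inverse_oneB.
  move: ya xs; rewrite rnorm_direct_sum/= ltr_pdivlMr// mulrC.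
  rewrite -[@rnorm _ _ (a : regular_module A)]/(rnorm (a : A)).
  by have := rnorm_ge0 y; lra.
have [_ SD _ Sa] := S_sub.
rewrite -(X_unital x) -va lactA; apply: (Sa).
have -> : lact (bone - (a : A)) x = s + phi y.
  rewrite lactDl X_unital -[- (a : A)]scaleN1r lactZl scaleN1r.
  apply/eqP; rewrite subr_eq -addrA -[phi y + _]/(T (y, a)) Tya.
  by rewrite addrC subrK.
by apply: SD => //; apply: phiS; exists y.
Qed.

Lemma maximal_mono_cyclic (Y : banachModType A) (alpha : morphism Y X) (x : X) :
  maximal_mono alpha -> ~ range alpha x ->
  forall z, exists y (a : A), z = alpha y + lact a x.
Proof.
move=> [_ [alpha_contr alpha_inj] _ alpha_max] nx.
apply: contrapT => ngen; apply: nx.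
(* Rescaling [x] into the unit ball makes [T] contractive without changing the submodule [A x];
   adding 1 avoids dividing by zero. *)
pose k : R := (rnorm x + 1)^-1.
have x1 : 0 < rnorm x + 1 by rewrite ltr_wpDl ?rnorm_ge0.
have k0 : 0 < k by rewrite invr_gt0.
have kC0 : k%:C != 0 by rewrite (fmorph_eq0 (real_complex R)) gt_eqF.
have kx1 : rnorm (k%:C *: x) <= 1.
  rewrite rnormZr; last exact: ltW.
  by rewrite ler_pdivrMl// mulr1 lerDl.
pose T := sum_morphism alpha (orbit_morphism (k%:C *: x)).
have T_contr : contractive T.
  move=> [y a]; rewrite rnorm_le rnorm_direct_sum/=.
  apply: le_trans (rnormD _ _) _; apply: lerD; first by rewrite -rnorm_le.
  by apply: le_trans (rnorm_lact _ _) _; rewrite ler_piMr ?rnorm_ge0.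
pose S := range_normed_submodule T_contr.
have alphaT y : T (y, 0) = alpha y.
  by rewrite -[LHS]/(alpha y + orbit_morphism (k%:C *: x) 0) linear0 addr0.
have alphaS y : nsub_set S (alpha y) by exists (y, 0).
have alphaN y : nsub_norm S (alpha y) <= rnorm y.
  rewrite -alphaT; apply: le_trans (quotient_norm_le _ _) _.
  by rewrite rnorm_direct_sum/= rnorm0 addr0.
(* [alpha] factors through the range of [T], which is proper by [ngen]. Maximality makes the
   corestriction onto, so [x], a point of that range, comes from [Y]. *)
have [|||[g _ gK] _] := alpha_max _ (nsub_incl S) (corestriction alphaS alphaN)
    (@nsub_incl_contractive _ _ _ S) (@nsub_incl_inj _ _ _ S).
- rewrite /surjective range_nsub_incl => ST; apply: ngen => z.
  have [[y a] _ <-] : nsub_set S z by rewrite ST.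
  by exists y, (k%:C *: a); rewrite lactZl -lactZr.
- by move=> y; rewrite rnorm_le; exact: alphaN.
- by [].
have xS : nsub_set S x.
  exists (0, k%:C^-1 *: (bone : A)) => //.
  rewrite [LHS]/= linear0 add0r.
  by rewrite [LHS]lactZl lactZr X_unital scalerA mulVf ?scale1r.
pose w := NSub (introT (nsub_predP S x) xS).
by exists (g w) => //; exact: (congr1 (nsub_incl S) (gK w)).
Qed.

Lemma maximal_mono_closed (Y : banachModType A) (alpha : morphism Y X) :
  maximal_mono alpha -> closed (range alpha).
Proof.
move=> alpha_max x; apply: contraPP => nx.
have gen := maximal_mono_cyclic alpha_max nx.
move=> clx; apply: nx.
exact: closure_cyclic_generator gen (range_submodule alpha) _ clx.
Qed.

(** If a point [x] of [range psi] were outside [range alpha], then [range alpha] and [A x], a part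
    of [range psi], would add up to [X], and smallness would make [alpha] onto. *)
Lemma small_sub_maximal (X0 Y : banachModType A) (psi : morphism X0 X)
    (alpha : morphism Y X) :
  small psi -> maximal_mono alpha -> range psi `<=` range alpha.
Proof.
move=> psi_small alpha_max x psix; apply: contrapT => nx.
have [_ _ + _] := alpha_max; apply; apply: psi_small.
apply/seteqP; split=> // z _.
have [y [a ->]] := maximal_mono_cyclic alpha_max nx z.
exists (alpha y); first by exists y.
exists (lact a x) => //.
by have [_ _ _ psia] := range_submodule psi; exact: psia.
Qed.

Lemma exists_maximal_submodule (N : set X) (x : X) : is_submodule N -> ~ N x ->
  exists S, [/\ is_submodule S, N `<=` S, ~ S x &
    forall S', is_submodule S' -> S `<=` S' -> ~ S' x -> S' = S].
Proof.
move=> N_sub nNx.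
(* [Zorn_bigcup] also asks for the union of the empty chain; adjoining [N] makes the empty set
   satisfy [P]. *)
pose P S := is_submodule (N `|` S) /\ ~ (N `|` S) x.
have [|S [[S_sub nSx] S_max]] := @Zorn_bigcup X P.
  move=> F FP F_tot; split; last first.
    by move=> [/nNx//|[S FS Sx]]; have [_ nSx] := FP _ FS; apply: nSx; right.
  have [N0 ND NZ Na] := N_sub.
  split; first by left.
  - move=> u v [Nu|[S FS Su]] [Nv|[S' FS' Sv]].
    + by left; exact: ND.
    + have [[_ SD _ _] _] := FP _ FS'.
      have [|] := SD u v (or_introl Nu) (or_intror Sv);
        by [left|right; exists S'].
    + have [[_ SD _ _] _] := FP _ FS.
      have [|] := SD u v (or_intror Su) (or_introl Nv);
        by [left|right; exists S].
    + have [SS'|SS'] := F_tot _ _ FS FS'.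
        have [[_ SD _ _] _] := FP _ FS'.
        have [|] := SD u v (or_intror (SS' _ Su)) (or_intror Sv);
          by [left|right; exists S'].
      have [[_ SD _ _] _] := FP _ FS.
      have [|] := SD u v (or_intror Su) (or_intror (SS' _ Sv));
        by [left|right; exists S].
  - move=> k u [Nu|[S FS Su]]; first by left; exact: NZ.
    have [[_ _ SZ _] _] := FP _ FS.
    by have [|] := SZ k u (or_intror Su); [left|right; exists S].
  - move=> a u [Nu|[S FS Su]]; first by left; exact: Na.
    have [[_ _ _ Sa] _] := FP _ FS.
    by have [|] := Sa a u (or_intror Su); [left|right; exists S].
exists (N `|` S); split=> // S' S'_sub NSS' nS'x.
have NS' : N `|` S' = S' by apply/setUidPr => u Nu; apply: NSS'; left.
apply/seteqP; split=> //; apply: contrapT => nsub.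
(* Were [S'] not inside the union of [N] and [S], it would be a strictly larger set than [S]
   satisfying [P]. *)
apply: (S_max S'); last by split; rewrite NS'.
split; first by move=> u Su; apply: NSS'; right.
by move=> S'S; apply: nsub => u /S'S; right.
Qed.

Lemma orbit_small (x : X) :
  maximal_intersection X x -> small (orbit_morphism x).
Proof.
move=> x_max Y phi sumT; apply: contrapT => nphi.
have gen z : exists y (a : A), z = phi y + lact a x.
  have : [set u + v | u in range phi & v in range (orbit_morphism x)] z.
    by rewrite sumT.
  by move=> [_ [y _ <-] [_ [a _ <-] <-]]; exists y, a.
have full (S : set X) : is_submodule S -> range phi `<=` S -> S x -> S = setT.
  move=> [_ SD _ Sa] phiS Sx; apply/seteqP; split=> // z _.
  have [y [a ->]] := gen z; apply: SD; last exact: Sa.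
  by apply: phiS; exists y.
have nphix : ~ range phi x.
  by move=> /(full _ (range_submodule phi) (@subset_refl _ _)).
have [S [S_sub phiS nSx S_max]] :=
  exists_maximal_submodule (range_submodule phi) nphix.
(* The closure of [S] is a submodule that still misses [x], by [closure_cyclic_generator], so
   maximality of [S] identifies the two. *)
have S_closed : closed S.
  move=> z; rewrite -[in X in _ -> X](S_max (closure S)) //.
  - exact: closure_submodule.
  - exact: subset_closure.
  - by move=> /(closure_cyclic_generator gen S_sub phiS).
pose N := closed_normed_submodule S_sub S_closed.
suff /x_max : maximal_mono (nsub_incl N) by rewrite range_nsub_incl.
split.
- by split=> // z; apply: val_inj; exact: X_unital.
- by split; [exact: nsub_incl_contractive|exact: nsub_incl_inj].
- rewrite /surjective range_nsub_incl => NT.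
  by apply: nSx; rewrite -[S]/(nsub_set N) NT.
move=> Z beta kappa beta_contr beta_inj beta_nsurj kappa_contr incl.
have inclE z : nsub_val z = beta (kappa z).
  exact: (congr1 (fun f => f z) incl).
have Sbeta : S `<=` range beta.
  move=> z; rewrite -[S]/(nsub_set N) -range_nsub_incl => -[s _ <-].
  by exists (kappa s) => //; rewrite -inclE.
(* If the range of [beta] contained [x], it would be all of [X] by [full]; since it contains [S],
   maximality leaves only [S]. *)
have betaS : range beta = S.
  apply: S_max; first exact: range_submodule.
  - exact: Sbeta.
  - move=> betax; apply: beta_nsurj.
    apply: full => //; first exact: range_submodule.
    exact: subset_trans phiS Sbeta.
split.
  have beta_val z : nsub_set N (beta z) by rewrite /= -betaS; exists z.
  exists (fun z => NSub (introT (nsub_predP N (beta z)) (beta_val z))).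
    by move=> s; apply: val_inj; rewrite [LHS]/= -inclE.
  by move=> z; apply: beta_inj; rewrite -inclE.
(* The norm of [s] is that of [beta (kappa s)] in [X], so it is squeezed between two
   contractions. *)
move=> s; apply/le_anti; rewrite kappa_contr/=.
rewrite (le_trans _ (beta_contr _))// -inclE rnorm_le.
exact: lexx.
Qed.

End CyclicModuloRange.

(** * Equality of the union and the intersection, and closedness *)

Theorem theorem4p2 (R : realType) (A : banachAlgType R[i])
    (X : banachModType A) (hX : unital_module X) :
  small_union X = maximal_intersection X /\
  is_submodule (small_union X) /\
  closed (small_union X).
Proof.
have -> : small_union X = maximal_intersection X.
  apply/seteqP; split=> x.
    move=> [X0 [psi [psi_small psix]]] Y gamma.
    by move=> /(small_sub_maximal hX psi_small); apply.
  (* By unitality [x] is the image of [bone] under its own orbit morphism. *)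
  move=> x_max; exists (regular_module A), (orbit_morphism x).
  split; first exact: orbit_small.
  by exists bone => //; exact: hX.
split=> //; split.
  split.
  - by move=> Y gamma _; have [] := range_submodule gamma.
  - move=> x y xm ym Y gamma g; have [_ D _ _] := range_submodule gamma.
    by apply: D; [exact: xm|exact: ym].
  - move=> k x xm Y gamma g; have [_ _ Z _] := range_submodule gamma.
    by apply: Z; exact: xm.
  - move=> a x xm Y gamma g; have [_ _ _ L] := range_submodule gamma.
    by apply: L; exact: xm.
move=> x clx Y gamma g; apply: (maximal_mono_closed hX g).
by apply: closure_subset clx => y ym; exact: ym.
Qed.
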